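(* Consider $f^*:=\min_{x\in\mathbb{R}^n}\{f(x):=\sum_{i=1}^mf_i(x)\}$, whose set of optimal solutions $X^*$ is assumed nonempty. For $\epsilon>0$, let $$\delta=\frac{L\epsilon}2$$ and apply the RPDG method, with the parameter settings given in the context, to the perturbation problem $$f_\delta^*:=\min_{x\in\mathbb{R}^n}\Big\{f_\delta(x):=f(x)+\frac\delta2\|x-x^0\|_2^2\Big\}.$$ Then one can find a solution $\bar x\in\mathbb{R}^n$ such that $\mathbb{E}[R_{ac}(\bar x,x^0,f^* )]\le\epsilon$ in at most $$\mathcal{O}\Big\{\sqrt{\frac m\epsilon}\,\log\frac m\epsilon\Big\}$$ iterations. Moreover, one can find a solution $\bar x\in\mathbb{R}^n$ such that $\mathrm{Prob}\{R_{ac}(\bar x,x^0,f^* )>\epsilon\}\le\lambda$, for any $\lambda\in(0,1)$, in at most $$\mathcal{O}\Big\{\sqrt{\frac m\epsilon}\,\log\frac m{\lambda\epsilon}\Big\}$$ iterations.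
   Context: $f_i:\mathbb{R}^n\to\mathbb{R}$ ($i=1,\dots,m$) are convex and differentiable with $L_i$-Lipschitz continuous gradients, $L=\sum_{i=1}^mL_i$; $\|\cdot\|_2$ is the Euclidean norm; $x^0\in\mathbb{R}^n$ is given. The relative accuracy of $\bar x$ is $$R_{ac}(\bar x,x^0,f^* ):=\frac{2[f(\bar x)-f^*]}{L(1+\min_{u\in X^*}\|x^0-u\|_2^2)}.$$ The perturbation problem is, up to a constant, of the form $\min_x\{f(x)+h(x)+\delta\,\omega(x)\}$ with $\omega(x)=\frac12\|x\|_2^2$, $h(x)=-\delta\langle x^0,x\rangle$; $L_\delta=L+\delta$ denotes the Lipschitz constant for $\nabla f_\delta$. RPDG method for it: $x^{-1}=x^0$, $\underline x_i^0=x^0$, $y_i^0=\nabla f_i(x^0)$. For $t=1,\dots,k$: draw $i_t$ independently with $\mathrm{Prob}\{i_t=i\}=p_i$; $\tilde x^t=\alpha(x^{t-1}-x^{t-2})+x^{t-1}$; for $i=i_t$: $\underline x_i^t=(\tilde x^t+\tau\underline x_i^{t-1})/(1+\tau)$, $y_i^t=\nabla f_i(\underline x_i^t)$, $\tilde y_i^t=p_i^{-1}(y_i^t-y_i^{t-1})+y_i^{t-1}$; for $i\neq i_t$: $\underline x_i^t=\underline x_i^{t-1}$, $y_i^t=\tilde y_i^t=y_i^{t-1}$; then $x^t=\arg\min_{x\in\mathbb{R}^n}\{\langle\sum_i\tilde y_i^t,x\rangle+\frac\delta2\|x-x^0\|_2^2+\frac\eta2\|x-x^{t-1}\|_2^2\}$.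 Output: $\bar x^k=(\sum_{t=1}^k\theta_t)^{-1}\sum_{t=1}^k\theta_tx^t$, $\theta_t=\alpha^{-t}$. Parameter settings: $p_i=\frac1{2m}+\frac{L_i}{2L}$, $C=8L_\delta/\delta$, $\tau=\frac{\sqrt{(m-1)^2+4mC}-(m-1)}{2m}$, $\eta=\frac{\delta\sqrt{(m-1)^2+4mC}+\delta(m-1)}2$, $\alpha=1-\frac1{(m+1)+\sqrt{(m-1)^2+4mC}}$. $\mathcal{O}$ hides absolute constants.
   Formalization: Bounds are for mε ≤ c (any fixed c, constant depending only on c) and m/ε ≥ 2, resp. m/(λε) ≥ 2. One absolute constant for all m, ε is impossible: for ε = 1/2, f_i = (L/2m)‖x‖², RPDG needs Ω(m) steps; as ε→m the logarithm vanishes. *)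

(* Defs.v *)
(* World: MathComp / MathComp-Analysis. *)
From HB Require Import structures.
From mathcomp Require Import all_boot all_order all_algebra.
From mathcomp Require Import all_classical all_reals all_analysis.
Set Implicit Arguments.
Unset Strict Implicit.
Unset Printing Implicit Defensive.
Import Order.TTheory GRing.Theory Num.Theory.
Import numFieldNormedType.Exports.
Local Open Scope classical_set_scope.
Local Open Scope ring_scope.

(* The library norm on 'rV[R]_n is the sup norm, hence a separate Euclidean
   norm.  Differentiability does not depend on the choice. *)
Definition edot (R : realType) (n : nat) (u v : 'rV[R]_n) : R :=
  \sum_(j < n) u 0 j * v 0 j.

Definition enorm (R : realType) (n : nat) (u : 'rV[R]_n) : R :=
  Num.sqrt (edot u u).

Definition gradient (R : realType) (n : nat) (f : 'rV[R]_n -> R^o)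
    (x : 'rV[R]_n) : 'rV[R]_n :=
  \row_(j < n) 'D_(delta_mx 0 j) f x.

Definition minimizers (R : realType) (n : nat) (f : 'rV[R]_n -> R^o) :
    set 'rV[R]_n :=
  [set u | forall x, f u <= f x].

(* Some minimizer, and 0 if there is none; the objective of the proximal step
   below is strongly convex and has exactly one minimizer. *)
Definition argmin (R : realType) (n : nat) (f : 'rV[R]_n -> R^o) : 'rV[R]_n :=
  xget 0 (minimizers f).

Section FiniteSum.
Context (R : realType) (m n : nat).
Implicit Types (f : 'I_m -> 'rV[R]_n -> R^o) (Li : 'I_m -> R).

Definition fsum f (x : 'rV[R]_n) : R^o := \sum_(i < m) f i x.

(* The positivity of \sum_i Li i is what makes the division by L in the relative
   accuracy (and the parameter delta > 0) meaningful. *)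
Definition smooth_convex_sum f Li : Prop :=
  [/\ forall i, convex_function [set: 'rV[R]_n] (f i),
      forall i x, differentiable (f i) x,
      forall i, 0 <= Li i /\
        forall x y, enorm (gradient (f i) x - gradient (f i) y)
                    <= Li i * enorm (x - y),
      0 < \sum_(i < m) Li i
    & minimizers (fsum f) !=set0].

(* For f = \sum_i f_i as above, both infima are attained as soon as f has a
   minimizer: they are the minimal value f^* and the minimum over X^*. *)
Definition min_value (f : 'rV[R]_n -> R^o) : R := inf (range f).

Definition min_sqdist (x0 : 'rV[R]_n) (X : set 'rV[R]_n) : R :=
  inf [set enorm (x0 - u) ^+ 2 | u in X].

Definition Rac f Li (x0 xbar : 'rV[R]_n) : R :=
  2 * (fsum f xbar - min_value (fsum f)) /
  ((\sum_(i < m) Li i) * (1 + min_sqdist x0 (minimizers (fsum f)))).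

Section Settings.
Variables (Li : 'I_m -> R) (delta : R).

Let L : R := \sum_(i < m) Li i.

Definition rpdg_p (i : 'I_m) : R := 1 / (2 * m%:R) + Li i / (2 * L).

Definition rpdg_C : R := 8 * (L + delta) / delta.

Let M : R := m%:R - 1.
Let S : R := Num.sqrt (M ^+ 2 + 4 * m%:R * rpdg_C).

Definition rpdg_tau : R := (S - M) / (2 * m%:R).

Definition rpdg_eta : R := (delta * S + delta * M) / 2.

Definition rpdg_alpha : R := 1 - 1 / ((m%:R + 1) + S).

End Settings.

(* Iterates after step t: x^t, x^(t-1), (\underline x_i^t)_i and (y_i^t)_i. *)
Record rpdg_state := RPDGState {
  cur : 'rV[R]_n;
  prev : 'rV[R]_n;
  und : 'I_m -> 'rV[R]_n;
  dual : 'I_m -> 'rV[R]_n }.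

Section Method.
Variables (f : 'I_m -> 'rV[R]_n -> R^o) (Li : 'I_m -> R).
Variables (x0 : 'rV[R]_n) (delta : R).

Let p := rpdg_p Li.
Let tau := rpdg_tau Li delta.
Let eta := rpdg_eta Li delta.
Let alpha := rpdg_alpha Li delta.

Definition rpdg_init : rpdg_state :=
  RPDGState x0 x0 (fun=> x0) (fun i => gradient (f i) x0).

Definition rpdg_step (it : 'I_m) (s : rpdg_state) : rpdg_state :=
  let xtilde := alpha *: (cur s - prev s) + cur s in
  let xund i :=
    if i == it then (1 + tau)^-1 *: (xtilde + tau *: und s i) else und s i in
  let y i := if i == it then gradient (f i) (xund i) else dual s i in
  let ytilde i :=
    if i == it then (p i)^-1 *: (y i - dual s i) + dual s i else dual s i in
  let xnew := argmin (fun x =>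
    edot (\sum_(i < m) ytilde i) x + delta / 2 * enorm (x - x0) ^+ 2
    + eta / 2 * enorm (x - cur s) ^+ 2) in
  RPDGState xnew (cur s) xund y.

(* draw t is the index i_t; only the values at t = 1, 2, ... are used. *)
Fixpoint rpdg (draw : nat -> 'I_m) (t : nat) : rpdg_state :=
  if t is t'.+1 then rpdg_step (draw t) (rpdg draw t') else rpdg_init.

(* Meaningful for 0 < k. *)
Definition rpdg_output (draw : nat -> 'I_m) (k : nat) : 'rV[R]_n :=
  (\sum_(1 <= t < k.+1) alpha ^- t)^-1 *:
  \sum_(1 <= t < k.+1) alpha ^- t *: cur (rpdg draw t).

End Method.
End FiniteSum.

(* The random indices i_1, ..., i_k are mutually independent with
   Prob{i_t = j} = p j. *)
Definition independent_draws (R : realType) (d : measure_display)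
    (Omega : measurableType d) (P : probability Omega R) (m : nat)
    (p : 'I_m -> R) (k : nat) (draw : nat -> Omega -> 'I_m) : Prop :=
  (forall t j, (1 <= t <= k)%N ->
     measurable [set w | draw t w = j] /\
     P [set w | draw t w = j] = (p j)%:E) /\
  (forall (T : seq nat) (j : nat -> 'I_m), uniq T ->
     {in T, forall t, (1 <= t <= k)%N} ->
     P [set w | {in T, forall t, draw t w = j t}] =
     (\prod_(t <- T) P [set w | draw t w = j t])%E).

(* Main.v *)
(** Let xs be the minimizer of the perturbed objective f_delta and D_i the
    Bregman distance of f_i.  With q_i = 1/p_i and b = x^t - x^(t-1), the
    function
      (eta/2 + delta) |x^t - xs|^2 + (1 + tau) \sum_i q_i D_i(\underline x_i^t, xs)
        + <\sum_i (y_i^t - \nabla f_i(xs)), b> + eta/4 |b|^2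
    dominates its first term and shrinks by the factor alpha in conditional
    expectation at each step, so E |x^t - xs|^2 <= (1 + 4/eps) alpha^t |x^0 - xs|^2.
    Since f_delta is (L + delta)-smooth and stationary at xs, its optimality gap
    at the averaged iterate is at most (L + delta)/2 |\bar x - xs|^2, of
    expectation O(k alpha^k); the perturbation itself costs at most eps/2 of
    relative accuracy.  Markov's inequality gives the bound in probability. *)
Require Import Defs.
From HB Require Import structures.
From mathcomp Require Import all_boot all_order all_algebra.
From mathcomp Require Import all_classical all_reals all_analysis.
From mathcomp Require Import measurable_realfun zify ring lra.
Set Implicit Arguments.
Unset Strict Implicit.
Unset Printing Implicit Defensive.
Import Order.TTheory GRing.Theory Num.Theory.
Import numFieldNormedType.Exports.
Local Open Scope classical_set_scope.
Local Open Scope ring_scope.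

(** * Euclidean geometry and smooth convex functions *)

Section Euclidean.
Context (R : realType) (n : nat).
Implicit Types (u v w : 'rV[R]_n) (a b : R).

Lemma edotC u v : edot u v = edot v u.
Proof. by apply: eq_bigr => j _; rewrite mulrC. Qed.

Lemma edotDl u v w : edot (u + v) w = edot u w + edot v w.
Proof. by rewrite -big_split; apply: eq_bigr => j _; rewrite mxE mulrDl. Qed.

Lemma edotDr u v w : edot w (u + v) = edot w u + edot w v.
Proof. by rewrite edotC edotDl !(edotC w). Qed.

Lemma edotZl a u v : edot (a *: u) v = a * edot u v.
Proof. by rewrite /edot mulr_sumr; apply: eq_bigr => j _; rewrite mxE mulrA. Qed.

Lemma edotZr a u v : edot v (a *: u) = a * edot v u.
Proof. by rewrite edotC edotZl edotC. Qed.

Lemma edotNl u v : edot (- u) v = - edot u v.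
Proof. by rewrite -scaleN1r edotZl mulN1r. Qed.

Lemma edotNr u v : edot v (- u) = - edot v u.
Proof. by rewrite edotC edotNl edotC. Qed.

Definition edotE := (edotDl, edotDr, edotNl, edotNr, edotZl, edotZr).

Lemma edot0l u : edot 0 u = 0.
Proof. by rewrite -(scale0r 0) edotZl mul0r. Qed.

Lemma edot_suml (I : Type) (r : seq I) (F : I -> 'rV[R]_n) v :
  edot (\sum_(i <- r) F i) v = \sum_(i <- r) edot (F i) v.
Proof.
by apply: (big_morph (fun u => edot u v)) => [x y|]; rewrite (edotDl, edot0l).
Qed.

Lemma edot_ge0 u : 0 <= edot u u.
Proof. by apply: sumr_ge0 => j _; rewrite -expr2 sqr_ge0. Qed.

Lemma edot_eq0 u : (edot u u == 0) = (u == 0).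
Proof.
apply/eqP/eqP => [|->]; last by rewrite edot0l.
move/(psumr_eq0P (fun j _ => sqr_ge0 (u 0 j))) => u0.
apply/rowP => j; rewrite mxE; have /eqP := u0 j isT.
by rewrite mulf_eq0 orbb => /eqP.
Qed.

Lemma enorm_sq u : enorm u ^+ 2 = edot u u.
Proof. by rewrite sqr_sqrtr// edot_ge0. Qed.

Lemma enorm_ge0 u : 0 <= enorm u.
Proof. exact: sqrtr_ge0. Qed.

Lemma edot_young a u v : 0 < a ->
  edot u v <= a * edot u u + (4 * a)^-1 * edot v v.
Proof.
move=> a0; have := edot_ge0 ((2 * a) *: u - v).
rewrite !edotE (edotC v u) => h.
rewrite -(ler_pM2l (_ : 0 < 4 * a)) ?mulr_gt0// mulrDr mulVKf ?mulf_neq0 ?gt_eqF//.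
rewrite -subr_ge0; apply: le_trans h _; rewrite le_eqVlt; apply/orP; left.
by apply/eqP; ring.
Qed.

Lemma edot_CS u v : edot u v <= enorm u * enorm v.
Proof.
have [->|u0] := eqVneq u 0; first by rewrite edot0l mulr_ge0 ?enorm_ge0.
have [->|v0] := eqVneq v 0; first by rewrite edotC edot0l mulr_ge0 ?enorm_ge0.
have nu : 0 < enorm u by rewrite sqrtr_gt0 lt_def edot_ge0 edot_eq0 u0.
have nv : 0 < enorm v by rewrite sqrtr_gt0 lt_def edot_ge0 edot_eq0 v0.
have := @edot_young (enorm v / (2 * enorm u)) u v.
rewrite divr_gt0 ?mulr_gt0// => /(_ isT) /le_trans; apply.
rewrite -!enorm_sq le_eqVlt; apply/orP; left; apply/eqP; field.
by rewrite !gt_eqF.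
Qed.

Lemma edot_convex_sum (r : seq nat) (th : nat -> R) (F : nat -> 'rV[R]_n) z v :
  (forall t, 0 <= th t) -> 0 < \sum_(t <- r) th t ->
  z = (\sum_(t <- r) th t)^-1 *: \sum_(t <- r) th t *: F t ->
  edot (z - v) (z - v) <=
    (\sum_(t <- r) th t)^-1 * \sum_(t <- r) th t * edot (F t - v) (F t - v).
Proof.
move=> th0; set S := \sum_(t <- r) th t => S0 zE.
have zS : \sum_(t <- r) th t *: (F t - v) = S *: (z - v).
  under eq_bigr do rewrite scalerBr.
  rewrite zE.
  by rewrite big_split /= sumrN -scaler_suml -/S scalerBr scalerA divff ?gt_eqF// scale1r.
have : 0 <= \sum_(t <- r) th t * edot ((F t - v) - (z - v)) ((F t - v) - (z - v)).
  by apply: sumr_ge0 => t _; rewrite mulr_ge0 ?edot_ge0.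
move: (z - v) zS => e zS.
have -> : \sum_(t <- r) th t * edot (F t - v - e) (F t - v - e) =
    \sum_(t <- r) th t * edot (F t - v) (F t - v) - S * edot e e.
  transitivity (\sum_(t <- r) (th t * edot (F t - v) (F t - v)
       + (- 2) * edot (th t *: (F t - v)) e + th t * edot e e)).
    apply: eq_bigr => t _; move: (F t - v) => g.
    by rewrite !edotE (edotC e g); ring.
  rewrite !big_split /= -mulr_suml -mulr_sumr -/S.
  by rewrite -edot_suml zS edotZl; ring.
rewrite subr_ge0 => h.
by rewrite -(ler_pM2l S0) mulrA divff ?gt_eqF// mul1r.
Qed.

End Euclidean.

Section Smooth.
Context (R : realType) (n : nat).
Implicit Types (f : 'rV[R]_n -> R^o) (x y u v : 'rV[R]_n) (L : R).

Lemma derive_gradient f x v : differentiable f x -> 'D_v f x = edot (gradient f x) v.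
Proof.
move=> df; rewrite deriveE// [in LHS](row_sum_delta v) linear_sum /edot.
by apply: eq_bigr => j _; rewrite linearZ mxE deriveE// mulrC.
Qed.

Lemma is_derive_line f x v (s : R) : differentiable f (x + s *: v) ->
  is_derive s 1 (fun r : R => f (x + r *: v)) (edot (gradient f (x + s *: v)) v).
Proof.
move=> df; have E : (fun h : R => h^-1 *:
      (((fun r : R => f (x + r *: v)) \o shift s) (h *: 1) - f (x + s *: v))) = (fun h : R => h^-1 *: ((f \o shift (x + s *: v)) (h *: v) - f (x + s *: v))).
  apply/funext => h /=; congr (_ *: (f _ - _)).
  rewrite [h *: 1]mulr1.
  by rewrite scalerDl addrCA.
split; first by rewrite /derivable E; exact: diff_derivable.
by rewrite /derive E -derive_gradient.
Qed.

Definition bregman f u v : R := f u - f v - edot (gradient f v) (u - v).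

Lemma bregman_three_point f u v w : bregman f u w =
  bregman f u v + bregman f v w + edot (gradient f v - gradient f w) (u - v).
Proof. by rewrite /bregman !edotE; ring. Qed.

Definition lipschitz_gradient f L := forall x y,
  enorm (gradient f x - gradient f y) <= L * enorm (x - y).

Section Lipschitz.
Variables (f : 'rV[R]_n -> R^o) (L : R).
Hypotheses (df : forall x, differentiable f x) (lf : lipschitz_gradient f L).

Lemma bregman_sign_le (sg : R) x y : `|sg| = 1 ->
  sg * bregman f y x <= L / 2 * edot (y - x) (y - x).
Proof.
move=> sg1; set v := y - x; set g := gradient f x.
pose psi (s : R) : R := sg * (f (x + s *: v) - s * edot g v) - L / 2 * edot v v * s ^+ 2.
pose dpsi (s : R) : R := sg * (edot (gradient f (x + s *: v)) v - edot g v) -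
   L / 2 * edot v v * (2 * s).
have dpsiP (s : R) : is_derive s 1 psi (dpsi s).
  have := is_derive_line (df (x + s *: v)) => H.
  rewrite /psi /dpsi.
  apply: is_derive_eq.
  rewrite /GRing.scale /=; ring.
have [c c01] : exists2 c, c \in `]0, 1[%R & psi 1 - psi 0 = dpsi c * (1 - 0).
  apply: MVT => //.
  apply: derivable_within_continuous => s _.
  by have [] := dpsiP s.
rewrite subr0 mulr1 => E.
have : dpsi c <= 0.
  move: c01; rewrite in_itv /= => /andP[c0 c1].
  rewrite /dpsi -edotNl -edotDl subr_le0.
  apply: (@le_trans _ _ (enorm (gradient f (x + c *: v) - g) * enorm v)).
    apply: le_trans (ler_norm _) _; rewrite normrM sg1 mul1r ler_norml.
    rewrite -lerNl -edotNl edot_CS andbT; apply: le_trans (edot_CS _ _) _.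
    by rewrite /enorm edotNl edotNr opprK.
  have -> : L / 2 * edot v v * (2 * c) = L * enorm (x + c *: v - x) * enorm v.
    rewrite addrAC subrr add0r -enorm_sq.
    have -> : enorm (c *: v) = c * enorm v.
      by rewrite /enorm edotZl edotZr mulrA -expr2 sqrtrM ?sqr_ge0// sqrtr_sqr gtr0_norm.
    by field.
  by rewrite ler_wpM2r ?enorm_ge0 ?lf.
rewrite -E /psi scale1r scale0r addr0 /bregman -/v -/g.
have -> : x + v = y by rewrite addrC subrK.
move=> h; rewrite -subr_le0; apply: le_trans h.
by rewrite le_eqVlt; apply/orP; left; apply/eqP; ring.
Qed.

Lemma bregman_le x y : bregman f y x <= L / 2 * edot (y - x) (y - x).
Proof. by have := @bregman_sign_le 1 x y; rewrite normr1 mul1r; apply. Qed.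

Lemma bregmanN_le x y : - bregman f y x <= L / 2 * edot (y - x) (y - x).
Proof. by have := @bregman_sign_le (-1) x y; rewrite normrN normr1 mulN1r; apply. Qed.

Hypothesis L0 : 0 <= L.
Hypothesis cf : convex_function [set: 'rV[R]_n] f.

(* The two-sided smoothness bound replaces the limit defining the gradient:
   along the chord, f lies below the segment by convexity and above its tangent
   minus a quadratic, which a short enough step contradicts. *)
Lemma bregman_ge0 u v : 0 <= bregman f u v.
Proof.
have cs (s : R) : 0 <= s <= 1 -> f (v + s *: (u - v)) <= s * f u + (1 - s) * f v.
  move=> s01; have := cf (Itv01 (andP s01).1 (andP s01).2)
    (mem_set (I : setT u)) (mem_set (I : setT v)).
  rewrite convRE /conv /= /unstable.onem.
  by have -> // : v + s *: (u - v) = s *: u + (1 - s) *: v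
    by rewrite scalerBl scale1r scalerBr addrCA.
rewrite leNgt; apply/negP => b0.
set A := L / 2 * edot (u - v) (u - v).
have A0 : 0 <= A by rewrite mulr_ge0 ?divr_ge0 ?edot_ge0.
pose s := - bregman f u v / (A - bregman f u v).
have den : 0 < A - bregman f u v by rewrite subr_gt0 (lt_le_trans b0).
have s0 : 0 < s by rewrite divr_gt0 // oppr_gt0.
have s1 : s <= 1 by rewrite ler_pdivrMr// mul1r lerDr.
have sA : s * (A - bregman f u v) = - bregman f u v by rewrite mulfVK ?gt_eqF.
have h1 : f (v + s *: (u - v)) <= s * f u + (1 - s) * f v by apply: cs; rewrite ltW.
have h2 := bregmanN_le v (v + s *: (u - v)).
have addK : v + s *: (u - v) - v = s *: (u - v) by rewrite addrAC subrr add0r.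
have : s * (- bregman f u v) <= s * (s * A).
  apply: le_trans (_ : - bregman f (v + s *: (u - v)) v <= _).
    rewrite /bregman addK edotZr; move: h1; lra.
  apply: le_trans h2 _; rewrite addK edotZl edotZr /A.
  by rewrite le_eqVlt; apply/orP; left; apply/eqP; ring.
rewrite ler_pM2l// => h3.
have : s * bregman f u v < 0 by rewrite nmulr_llt0.
lra.
Qed.

(* Bound the Bregman distance to v at u - g / L, the minimizer of the quadratic
   upper model at u. *)
Lemma gradient_sq_le u v :
  edot (gradient f u - gradient f v) (gradient f u - gradient f v) <= 2 * L * bregman f u v.
Proof.
set g := gradient f u - gradient f v.
have [L00|Ln] := eqVneq L 0.
  rewrite L00 mulr0 mul0r -enorm_sq.
  have := lf u v; rewrite L00 mul0r -/g => h.
  by have -> : enorm g = 0; [apply/eqP; rewrite eq_le h enorm_ge0|rewrite expr0n].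
have Lp : 0 < L by rewrite lt_def Ln.
have h1 := bregman_ge0 (u - L^-1 *: g) v.
have h2 := bregman_le u (u - L^-1 *: g).
have := bregman_three_point f (u - L^-1 *: g) u v.
rewrite -/g => h3; rewrite h3 in h1.
have K : u - L^-1 *: g - u = - (L^-1 *: g) by rewrite addrAC subrr add0r.
rewrite K in h1 h2.
have E : L / 2 * edot (- (L^-1 *: g)) (- (L^-1 *: g)) + edot g (- (L^-1 *: g)) =
    - (edot g g / (2 * L)) by rewrite !edotE; field.
have : edot g g / (2 * L) <= bregman f u v by lra.
by rewrite ler_pdivrMr ?mulr_gt0// mulrC.
Qed.

End Lipschitz.
End Smooth.

Section Prox.
Context (R : realType) (n : nat).
Implicit Types (x y g : 'rV[R]_n).

Lemma argmin_prox g x0 xc (d e : R) : 0 < d -> 0 < e ->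
  let z := argmin (fun x =>
    edot g x + d / 2 * enorm (x - x0) ^+ 2 + e / 2 * enorm (x - xc) ^+ 2) in
  g + d *: (z - x0) + e *: (z - xc) = 0.
Proof.
move=> d0 e0; set F := (fun x : 'rV_n => _) => z.
pose z0 := (d + e)^-1 *: (d *: x0 + e *: xc - g).
have opt : g + d *: (z0 - x0) + e *: (z0 - xc) = 0.
  have : (d + e) *: z0 = d *: x0 + e *: xc - g.
    by rewrite scalerA divff ?gt_eqF ?addr_gt0// scale1r.
  move: z0 => w h; apply/rowP => j; have := congr1 (fun v : 'rV_n => v 0 j) h.
  by rewrite !mxE; lra.
have FE x : F x = F z0 + (d + e) / 2 * edot (x - z0) (x - z0).
  rewrite -[in LHS](subrK z0 x); move: (x - z0) => w.
  rewrite /F !enorm_sq -!(addrA w) (addrC w).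
  have := congr1 (fun v => edot v w) opt.
  move: (z0 - x0) (z0 - xc) => a b.
  rewrite edot0l !edotE (edotC w a) (edotC w b).
  lra.
have z0min : minimizers F z0.
  by move=> x; rewrite (FE x) lerDl mulr_ge0 ?edot_ge0// divr_ge0// addr_ge0 ?ltW.
have zmin : minimizers F z by apply: xgetPex; exists z0.
have := zmin z0; rewrite FE gerDl => h.
suff -> : z = z0 by [].
apply/eqP; rewrite -subr_eq0 -edot_eq0 eq_le edot_ge0 andbT.
by move: h; rewrite pmulr_rle0// divr_gt0// addr_gt0.
Qed.

Lemma continuous_edot_sub x0 : continuous (fun x => edot (x - x0) (x - x0) : R^o).
Proof.
apply: (@continuous_big R^o) => [|j _ x]; first exact: add_continuous.
have h : continuous (fun y : 'rV[R]_n => (y - x0) 0 j : R^o).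
  rewrite (_ : (fun y : 'rV[R]_n => _) = (fun y : 'rV[R]_n => y 0 j - x0 0 j)); last first.
    by apply/funext => y; rewrite !mxE.
  move=> y; apply: (@continuousB _ R^o); first exact: coord_continuous.
  exact: cst_continuous.
by apply: continuousM; exact: h.
Qed.

Lemma perturbation_minimizer (F : 'rV[R]_n -> R^o) x0 (b d : R) : 0 < d ->
  continuous F -> (forall x, b <= F x) ->
  exists xs, forall x, F xs + d / 2 * edot (xs - x0) (xs - x0) <=
    F x + d / 2 * edot (x - x0) (x - x0).
Proof.
move=> d0 cF bF; pose G x : R := F x + d / 2 * edot (x - x0) (x - x0).
pose r := 1 + 2 * (F x0 - b) / d.
have r1 : 1 <= r by rewrite lerDl divr_ge0 ?mulr_ge0 ?subr_ge0 ?(ltW d0).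
pose A := [set v : 'rV[R]_n | forall i, `[x0 0 i - r, x0 0 i + r]%classic (v ord0 i)].
have cA : compact A.
  apply: (@rV_compact R n (fun i => `[x0 0 i - r, x0 0 i + r]%classic)) => i.
  exact: segment_compact.
have Ax0 : A x0.
  by move=> i /=; rewrite in_itv/= gerBl lerDl (le_trans ler01).
have cG : continuous G.
  move=> x; apply: (@continuousD R R^o _ F _ x); first exact: cF.
  by apply: continuousM; [exact: cst_continuous|exact: continuous_edot_sub].
have [|xs Axs xsmin] := @compact_EVT_min _ _ G A (ex_intro _ _ Ax0) cA.
  exact: continuous_subspaceT.
exists xs => x; rewrite -/(G xs) -/(G x).
have [Ax|nAx] := pselect (A x); first by apply: xsmin; rewrite inE.
apply: (le_trans (xsmin x0 _)); first by rewrite inE.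
rewrite /G subrr edot0l mulr0 addr0.
have [i xi] : exists i, r < `|x 0 i - x0 0 i|.
  apply: contrapT => h; apply: nAx => i /=.
  rewrite in_itv /= -ler_distl leNgt; apply/negP => ri; apply: h; exists i.
  by [].
have : r <= edot (x - x0) (x - x0).
  rewrite /edot (bigD1 i)//= -expr2 -[r]addr0 lerD//; last first.
    by apply: sumr_ge0 => j _; rewrite -expr2 sqr_ge0.
  rewrite !mxE -real_normK ?num_real//.
  apply: (le_trans (_ : r <= r ^+ 2)); first by rewrite expr2 ler_peMr// (le_trans ler01).
  rewrite ler_sqr ?nnegrE ?normr_ge0 ?(ltW xi)//.
  exact: le_trans r1.
move=> h; have : d / 2 * r <= d / 2 * edot (x - x0) (x - x0).
  by rewrite ler_pM2l// divr_gt0.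
have -> : d / 2 * r = d / 2 + (F x0 - b) by rewrite /r; field; rewrite gt_eqF.
have := bF x; lra.
Qed.
End Prox.

(** * The Lyapunov function of the RPDG method *)

Section Settings.
Context (R : realType) (m : nat) (Li : 'I_m -> R) (delta : R).
Local Notation L := (\sum_(i < m) Li i).
Hypotheses (m0 : (0 < m)%N) (Li0 : forall i, 0 <= Li i) (L0 : 0 < L) (d0 : 0 < delta).
Local Notation M := (m%:R - 1 : R).
Local Notation S := (Num.sqrt (M ^+ 2 + 4 * m%:R * rpdg_C Li delta)).

Let mR : (1 : R) <= m%:R. Proof. by rewrite ler1n. Qed.
Let mR0 : (0 : R) < m%:R. Proof. by rewrite ltr0n. Qed.

Lemma rpdg_p_ge_inv i : (2 * m%:R)^-1 <= rpdg_p Li i.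
Proof. by rewrite /rpdg_p mul1r lerDl divr_ge0 ?mulr_ge0 ?(ltW L0). Qed.

Lemma rpdg_p_gt0 i : 0 < rpdg_p Li i.
Proof. by apply: lt_le_trans (rpdg_p_ge_inv i); rewrite invr_gt0 mulr_gt0. Qed.

Lemma rpdg_p_ge_lip i : Li i <= 2 * L * rpdg_p Li i.
Proof.
rewrite /rpdg_p mulrDr [X in _ + X]mulrCA divff ?mulr1 ?mulf_neq0 ?gt_eqF//.
by rewrite lerDr !mulr_ge0 ?invr_ge0 ?mulr_ge0 ?(ltW L0) ?(ltW mR0).
Qed.

Lemma rpdg_p_sum : \sum_i rpdg_p Li i = 1.
Proof.
rewrite /rpdg_p big_split /= -!mulr_suml sumr_const card_ord.
field.
by rewrite !gt_eqF.
Qed.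

Lemma rpdg_p_le1 i : rpdg_p Li i <= 1.
Proof.
rewrite -rpdg_p_sum (bigD1 i)//= lerDl; apply: sumr_ge0 => j _.
exact/ltW/rpdg_p_gt0.
Qed.

Lemma rpdg_C_gt0 : 0 < rpdg_C Li delta.
Proof. by rewrite divr_gt0// mulr_gt0// addr_gt0. Qed.

Let mC_gt0 : 0 < 4 * m%:R * rpdg_C Li delta.
Proof. by rewrite mulr_gt0 ?rpdg_C_gt0// mulr_gt0. Qed.

Let arg_ge0 : 0 <= M ^+ 2 + 4 * m%:R * rpdg_C Li delta.
Proof. by rewrite addr_ge0 ?sqr_ge0// ltW. Qed.

Lemma rpdg_tau_gt0 : 0 < rpdg_tau Li delta.
Proof.
rewrite divr_gt0 ?mulr_gt0// subr_gt0.
have {1}-> : M = Num.sqrt (M ^+ 2) by rewrite sqrtr_sqr ger0_norm// subr_ge0.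
rewrite ltr_sqrt ?ltrDl//.
by rewrite ltr_wpDl ?sqr_ge0.
Qed.

Lemma rpdg_eta_gt0 : 0 < rpdg_eta Li delta.
Proof.
have : 0 < S by rewrite sqrtr_gt0 ltr_wpDl ?sqr_ge0.
move=> S0; by rewrite divr_gt0// -mulrDr mulr_gt0// ltr_pwDl// subr_ge0 mR.
Qed.

Lemma rpdg_eta_tau : rpdg_eta Li delta * rpdg_tau Li delta = 8 * (L + delta).
Proof.
have S2 : S ^+ 2 = M ^+ 2 + 4 * m%:R * rpdg_C Li delta by rewrite sqr_sqrtr.
transitivity (delta * (S ^+ 2 - M ^+ 2) / (4 * m%:R)).
  by rewrite /rpdg_eta /rpdg_tau; field; rewrite gt_eqF.
rewrite S2 /rpdg_C; field.
by rewrite !gt_eqF.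
Qed.

Definition rpdg_N : R := m%:R + 1 + S.

Lemma rpdg_N_gt1 : 1 < rpdg_N.
Proof.
have : 0 <= S by apply: sqrtr_ge0.
rewrite /rpdg_N; move: mR; lra.
Qed.

Lemma rpdg_alphaE : rpdg_alpha Li delta = 1 - rpdg_N^-1.
Proof. by rewrite /rpdg_alpha mul1r. Qed.

Lemma rpdg_tauE : 1 + rpdg_tau Li delta = rpdg_N / (2 * m%:R).
Proof. by rewrite /rpdg_tau /rpdg_N; field; rewrite gt_eqF. Qed.

Lemma rpdg_etaE : rpdg_eta Li delta / 2 + delta = delta * (rpdg_N + 2) / 4.
Proof. by rewrite /rpdg_eta /rpdg_N; field. Qed.

Lemma rpdg_alpha_gt0 : 0 < rpdg_alpha Li delta.
Proof. by rewrite rpdg_alphaE subr_gt0 invf_lt1 ?rpdg_N_gt1// (lt_trans _ rpdg_N_gt1). Qed.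

Lemma rpdg_alpha_le1 : rpdg_alpha Li delta <= 1.
Proof. by rewrite rpdg_alphaE gerBl invr_ge0 ltW// (lt_trans _ rpdg_N_gt1). Qed.

Lemma rpdg_eta_contract :
  rpdg_eta Li delta / 2 <= rpdg_alpha Li delta * (rpdg_eta Li delta / 2 + delta).
Proof.
have N1 := rpdg_N_gt1; have N0 : 0 < rpdg_N by apply: lt_trans N1.
have -> : rpdg_eta Li delta / 2 = delta * (rpdg_N - 2) / 4.
  by rewrite /rpdg_eta /rpdg_N; field.
have -> : delta * (rpdg_N - 2) / 4 + delta = delta * (rpdg_N + 2) / 4 by field.
rewrite rpdg_alphaE -subr_ge0.
have -> : (1 - rpdg_N^-1) * (delta * (rpdg_N + 2) / 4) - delta * (rpdg_N - 2) / 4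
   = delta * (3 * rpdg_N - 2) / (4 * rpdg_N) by field; rewrite gt_eqF.
by rewrite divr_ge0 ?mulr_ge0 ?(ltW d0) ?(ltW N0)//; lra.
Qed.

Lemma rpdg_alpha_tau i : (1 - rpdg_alpha Li delta) * (1 + rpdg_tau Li delta) <= rpdg_p Li i.
Proof.
apply: le_trans (rpdg_p_ge_inv i).
rewrite rpdg_alphaE rpdg_tauE opprB addrC subrK mulKf// gt_eqF//.
by apply: lt_trans rpdg_N_gt1.
Qed.
End Settings.

Section Lyapunov.
Context (R : realType) (m n : nat) (f : 'I_m -> 'rV[R]_n -> R^o) (Li : 'I_m -> R).
Variables (x0 xs : 'rV[R]_n) (delta : R).
Local Notation L := (\sum_(i < m) Li i).
Local Notation p := (rpdg_p Li).
Local Notation tau := (rpdg_tau Li delta).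
Local Notation eta := (rpdg_eta Li delta).
Local Notation alpha := (rpdg_alpha Li delta).

Definition dual_is_gradient (s : rpdg_state R m n) :=
  forall j, dual s j = gradient (f j) (und s j).

Definition dual_gap (s : rpdg_state R m n) : 'rV[R]_n :=
  \sum_j (dual s j - gradient (f j) xs).

(* [prev] alone would denote the path.v operation. *)
Definition lyapunov (s : rpdg_state R m n) : R :=
  (eta / 2 + delta) * edot (cur s - xs) (cur s - xs)
  + (1 + tau) * \sum_j (p j)^-1 * bregman (f j) (und s j) xs
  + edot (dual_gap s) (cur s - Defs.prev s)
  + eta / 4 * edot (cur s - Defs.prev s) (cur s - Defs.prev s).

Hypotheses (m0 : (0 < m)%N) (L0 : 0 < L) (d0 : 0 < delta).
Hypotheses (Li0 : forall i, 0 <= Li i) (df : forall i x, differentiable (f i) x)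
  (cf : forall i, convex_function [set: 'rV[R]_n] (f i))
  (lf : forall i, lipschitz_gradient (f i) (Li i)).
Hypothesis xsP : \sum_i gradient (f i) xs + delta *: (xs - x0) = 0.

Let p0 i : 0 < p i. Proof. exact: rpdg_p_gt0. Qed.
Let t0 : 0 < tau. Proof. exact: rpdg_tau_gt0. Qed.
Let e0 : 0 < eta. Proof. exact: rpdg_eta_gt0. Qed.

Let al0 : 0 < alpha. Proof. exact: rpdg_alpha_gt0. Qed.

Let breg_ge0 i u v : 0 <= bregman (f i) u v.
Proof. exact: (bregman_ge0 (df i) (lf i) (Li0 i) (cf i)). Qed.

Let breg0 i u v : 0 <= (p i)^-1 * bregman (f i) u v.
Proof. by rewrite mulr_ge0 ?invr_ge0 ?(ltW (p0 i)). Qed.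

(* Li i may vanish, so the gradient difference is controlled through the product
   (p i)^-1 * Li i <= 2 L rather than by dividing by Li i. *)
Lemma dual_young i (u v d : 'rV[R]_n) (r : R) : `|r| <= (p i)^-1 ->
  edot (r *: (gradient (f i) u - gradient (f i) v)) d <=
  tau / 2 * ((p i)^-1 * bregman (f i) u v) + eta / 4 * edot d d.
Proof.
move=> rq; set g := gradient _ u - _; set D := bregman _ _ _; set q := (p i)^-1 in rq *.
have q0 : 0 < q by rewrite invr_gt0.
have D0 : 0 <= D by exact: breg_ge0.
have gD : edot g g <= 2 * Li i * D by apply: (gradient_sq_le (df i) (lf i)).
have qL : q * Li i <= eta * tau / 4.
  rewrite mulrC ler_pdivrMr// rpdg_eta_tau//.
  apply: le_trans (rpdg_p_ge_lip m0 L0 i) _; rewrite ler_pM2r//.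
  by move: L0 d0; lra.
have rr : r ^+ 2 <= q ^+ 2 by rewrite -real_normK ?num_real// ler_sqr ?nnegrE ?(ltW q0).
apply: le_trans (edot_young (r *: g) d (_ : 0 < eta^-1)) _; first by rewrite invr_gt0.
have -> : (4 * eta^-1)^-1 = eta / 4 by field; rewrite gt_eqF.
rewrite lerD2r edotZl edotZr [r * (r * _)]mulrA -expr2.
rewrite mulrC ler_pdivrMr//.
apply: (@le_trans _ _ (q ^+ 2 * (2 * Li i * D))).
  by rewrite ler_pM ?sqr_ge0 ?edot_ge0.
have -> : q ^+ 2 * (2 * Li i * D) = (2 * q * D) * (q * Li i) by ring.
apply: le_trans (_ : 2 * q * D * (eta * tau / 4) <= _).
  by rewrite ler_wpM2l// !mulr_ge0// ltW.
by rewrite le_eqVlt; apply/orP; left; apply/eqP; field.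
Qed.

Lemma lyapunov_ge s : dual_is_gradient s ->
  (eta / 2 + delta) * edot (cur s - xs) (cur s - xs) <= lyapunov s.
Proof.
move=> sP; rewrite /lyapunov; set b := cur s - Defs.prev s.
set W := \sum_j _; rewrite -!addrA lerDl.
suff : - edot (dual_gap s) b <= tau / 2 * W + eta / 4 * edot b b.
  have W0 : 0 <= W.
    by apply: sumr_ge0 => j _; exact: breg0.
  have := mulr_ge0 (ltW t0) W0; move: (edot (dual_gap s) b) => x; lra.
rewrite -edotNl /dual_gap -sumrN edot_suml.
have -> : tau / 2 * W + eta / 4 * edot b b =
  \sum_i (tau / 2 * ((p i)^-1 * bregman (f i) (und s i) xs) + p i * (eta / 4 * edot b b)).
  by rewrite big_split /= -mulr_suml rpdg_p_sum// mul1r mulr_sumr.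
apply: ler_sum => i _; rewrite sP -scaleN1r.
set g := gradient _ _ - _.
have := @dual_young i (und s i) xs b (- (p i)^-1).
rewrite normrN ger0_norm ?invr_ge0 ?(ltW (p0 i))// => /(_ (lexx _)) /(ler_wpM2l (ltW (p0 i))).
rewrite -/g [X in p i * X <= _]edotZl mulNr mulrN mulVKf ?gt_eqF// mulrDr edotZl mulN1r.
move=> /le_trans; apply; rewrite lerD2r ler_piMl ?rpdg_p_le1//.
by rewrite mulr_ge0// divr_ge0// ltW.
Qed.

Lemma lyapunov_init : lyapunov (rpdg_init f x0) <=
  (eta / 2 + delta) * ((1 + 2 * L / delta) * edot (x0 - xs) (x0 - xs)).
Proof.
rewrite /lyapunov /= subrr !(edotC _ 0) !edot0l mulr0 !addr0.
set A := edot _ _; have A0 : 0 <= A by exact: edot_ge0.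
rewrite [(1 + 2 * L / delta) * A]mulrDl mul1r [(eta / 2 + delta) * (A + _)]mulrDr lerD2l.
have h : \sum_j (p j)^-1 * bregman (f j) x0 xs <= m%:R * (L * A).
  rewrite -[X in X%:R]card_ord mulr_natl -sumr_const; apply: ler_sum => j _.
  apply: le_trans (ler_wpM2l _ (bregman_le (df j) (lf j) _ _)) _.
    by rewrite invr_ge0 ltW.
  rewrite mulrA ler_wpM2r// mulrC ler_pdivrMr// ler_pdivrMr//.
  by have := rpdg_p_ge_lip m0 L0 j; lra.
apply: (le_trans (ler_wpM2l _ h)); first by rewrite addr_ge0// ltW.
rewrite rpdg_tauE// rpdg_etaE.
have -> : rpdg_N Li delta / (2 * m%:R) * (m%:R * (L * A)) = rpdg_N Li delta * (L * A) / 2.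
  by field; rewrite gt_eqF// ltr0n.
have -> : delta * (rpdg_N Li delta + 2) / 4 * (2 * L / delta * A) =
    rpdg_N Li delta * (L * A) / 2 + L * A by field; rewrite gt_eqF.
by rewrite lerDl mulr_ge0// ltW.
Qed.

Lemma sum_update (V : zmodType) (F G : 'I_m -> V) i :
  \sum_j (if j == i then F j else G j) = \sum_j G j + (F i - G i).
Proof.
rewrite (bigD1 i)//= eqxx [in RHS](bigD1 i)//= [RHS]addrC addrA subrK.
by congr (_ + _); apply: eq_bigr => j /negPf ->.
Qed.

Section Step.
Variable (s : rpdg_state R m n).
Hypothesis sP : dual_is_gradient s.
Let b := cur s - Defs.prev s.
Let a := cur s - xs.
Let u i := (1 + tau)^-1 *: (alpha *: b + cur s + tau *: und s i).
Let D i := gradient (f i) (u i) - gradient (f i) (und s i).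
Let e i := gradient (f i) (und s i) - gradient (f i) xs.
Let s' i := rpdg_step f Li x0 delta i s.

Let und_step i j : und (s' i) j = if j == i then u i else und s j.
Proof. by rewrite /s' /rpdg_step /=; case: eqP => // ->. Qed.

Lemma dual_is_gradient_step i : dual_is_gradient (s' i).
Proof. by move=> j; rewrite und_step /=; case: eqP => // ->. Qed.

Let dual_gap_step i : dual_gap (s' i) = dual_gap s + D i.
Proof.
transitivity (\sum_j (if j == i then gradient (f j) (u j) - gradient (f j) xs
    else dual s j - gradient (f j) xs)).
  apply: eq_bigr => j _; rewrite dual_is_gradient_step und_step.
  by case: eqP => [->//|_]; rewrite sP.
by rewrite sum_update; congr (_ + _); rewrite opprB addrA subrK /D sP.
Qed.

Let cur_step i :
  dual_gap s + (p i)^-1 *: D i + delta *: (cur (s' i) - xs)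
  + eta *: (cur (s' i) - cur s) = 0.
Proof.
pose y j := if j == i then (p j)^-1 *: (dual (s' i) j - dual s j) + dual s j else dual s j.
have yE : \sum_j y j = \sum_j dual s j + (p i)^-1 *: D i.
  by rewrite sum_update dual_is_gradient_step und_step eqxx addrK sP.
have := @argmin_prox _ _ (\sum_j y j) x0 (cur s) delta eta d0 e0.
have -> : argmin (fun x : 'rV[R]_n => edot (\sum_j y j) x + delta / 2 * enorm (x - x0) ^+ 2
     + eta / 2 * enorm (x - cur s) ^+ 2) = cur (s' i) by [].
move: (cur (s' i)) => z; rewrite yE /dual_gap big_split /= sumrN => h.
apply/rowP => j; have := congr1 (fun v : 'rV_n => v 0 j) h.
have := congr1 (fun v : 'rV_n => v 0 j) xsP.
move: (\sum_j _) (\sum_j _) => X Y.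
by rewrite !mxE; lra.
Qed.

(* The dual update is a mirror step in the Bregman distance of f i: use the
   three-point identity and (1 + tau) u i = xtilde + tau (und s i). *)
Let dual_step i :
  (1 + tau) * bregman (f i) (u i) xs + tau * bregman (f i) (und s i) (u i) <=
  tau * bregman (f i) (und s i) xs + edot (e i + D i) (a + alpha *: b).
Proof.
have h1 := bregman_three_point (f i) (und s i) (u i) xs.
have h2 : 0 <= bregman (f i) xs (u i) by exact: breg_ge0.
have h3 : edot (gradient (f i) (u i) - gradient (f i) xs) (u i - xs) =
    bregman (f i) (u i) xs + bregman (f i) xs (u i).
  by rewrite /bregman !edotE; ring.
have -> : e i + D i = gradient (f i) (u i) - gradient (f i) xs.
  by rewrite /e /D addrC addrA subrK.
have -> : a + alpha *: b = (u i - xs) - tau *: (und s i - u i).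
  have : (1 + tau) *: u i = alpha *: b + cur s + tau *: und s i.
    by rewrite /u scalerA divff ?scale1r// gt_eqF// addr_gt0.
  move: (u i) => w h; apply/rowP => j; have := congr1 (fun v : 'rV_n => v 0 j) h.
  by rewrite /a !mxE; lra.
rewrite edotDr edotNr edotZr h3 h1.
move: (bregman (f i) (und s i) (u i)) (bregman (f i) (u i) xs) (edot _ (und s i - u i)) h2.
move=> x y z h2; rewrite -subr_ge0; apply: le_trans h2 _.
by rewrite le_eqVlt; apply/orP; left; apply/eqP; ring.
Qed.

Let lyapunov_step_le i : lyapunov (s' i) <=
  eta / 2 * edot a a - edot (dual_gap s + (p i)^-1 *: D i) a
  + tau / 2 * ((p i)^-1 * bregman (f i) (und s i) (u i))
  + (1 + tau) * (\sum_j (p j)^-1 * bregman (f j) (und s j) xs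
     + (p i)^-1 * (bregman (f i) (u i) xs - bregman (f i) (und s i) xs)).
Proof.
have sumE : \sum_j (p j)^-1 * bregman (f j) (und (s' i) j) xs =
    \sum_j (p j)^-1 * bregman (f j) (und s j) xs
    + (p i)^-1 * (bregman (f i) (u i) xs - bregman (f i) (und s i) xs).
  rewrite mulrBr -(sum_update (fun j => (p j)^-1 * bregman (f j) (u j) xs)).
  by apply: eq_bigr => j _; rewrite und_step; case: eqP => // ->.
rewrite /lyapunov dual_gap_step sumE.
have -> : Defs.prev (s' i) = cur s by [].
have := cur_step i; move: (cur (s' i)) => z /(congr1 (fun v => edot v (z - xs))).
have -> : z - xs = (z - cur s) + a by rewrite /a addrA subrK.
rewrite edot0l; move: (z - cur s) => w.
have q1 : 1 <= (p i)^-1 by rewrite invf_ge1// rpdg_p_le1.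
have := @dual_young i (und s i) (u i) w ((p i)^-1 - 1).
rewrite ger0_norm ?subr_ge0// gerBl => /(_ ler01).
have -> : gradient (f i) (und s i) - gradient (f i) (u i) = - D i by rewrite opprB.
move: (dual_gap s) (D i) (a) => G Di a'.
rewrite !edotE (edotC w a').
set W := \sum_j _; move: (bregman _ _ _) (bregman _ _ _) (bregman _ _ _) => B1 B2 B3.
move=> h1 h2; rewrite -subr_ge0.
move: h1; rewrite -subr_ge0 => /le_trans; apply.
rewrite -[leLHS]subr0 -[X in _ - X]h2.
rewrite le_eqVlt; apply/orP; left; apply/eqP; field.
by rewrite gt_eqF.
Qed.

Lemma lyapunov_step : \sum_i p i * lyapunov (s' i) <= alpha * lyapunov s.
Proof.
set W := \sum_j (p j)^-1 * bregman (f j) (und s j) xs.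
apply: (@le_trans _ _ (\sum_i (p i * (eta / 2 * edot a a - edot (dual_gap s) a + (1 + tau) * W)
   + (edot (e i) a + alpha * edot (e i) b - bregman (f i) (und s i) xs
   + p i * (alpha * (eta / 4 * edot b b)))))).
  apply: ler_sum => i _.
  apply: (le_trans (ler_wpM2l (ltW (p0 i)) (lyapunov_step_le i))).
  have h1 := dual_step i.
  have h2 : alpha * (p i * edot ((p i)^-1 *: D i) b) <=
      tau / 2 * bregman (f i) (und s i) (u i) + p i * (alpha * (eta / 4 * edot b b)).
    have := @dual_young i (und s i) (u i) b (- (p i)^-1).
    rewrite normrN ger0_norm ?invr_ge0 ?(ltW (p0 i))// => /(_ (lexx _)).
    have -> : gradient (f i) (und s i) - gradient (f i) (u i) = - D i by rewrite opprB.
    rewrite scaleNr scalerN opprK => /(ler_wpM2l (ltW (p0 i))).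
    move=> /(ler_wpM2l (ltW al0)) /le_trans; apply.
    have -> : p i * (tau / 2 * ((p i)^-1 * bregman (f i) (und s i) (u i)) + eta / 4 * edot b b)
      = tau / 2 * bregman (f i) (und s i) (u i) + p i * (eta / 4 * edot b b).
      by field; rewrite gt_eqF.
    rewrite mulrDr [in X in _ + X]mulrCA lerD2r ler_piMl ?rpdg_alpha_le1//.
    by apply: mulr_ge0; [apply: divr_ge0 => //; exact: ltW|exact: breg_ge0].
  move: h1 h2; move: (D i) (e i) (a) (b) => Di ei a' b'.
  rewrite !edotE (mulVKf (lt0r_neq0 (p0 i))) => h1 h2.
  have -> : p i * (eta / 2 * edot a' a' - (edot (dual_gap s) a' + (p i)^-1 * edot Di a')
       + tau / 2 * ((p i)^-1 * bregman (f i) (und s i) (u i))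
       + (1 + tau) * (W + (p i)^-1 * (bregman (f i) (u i) xs - bregman (f i) (und s i) xs)))
     = p i * (eta / 2 * edot a' a' - edot (dual_gap s) a' + (1 + tau) * W)
      - edot Di a' + tau / 2 * bregman (f i) (und s i) (u i)
      + (1 + tau) * (bregman (f i) (u i) xs - bregman (f i) (und s i) xs).
    by field; rewrite gt_eqF.
  move: h1 h2; lra.
rewrite big_split /= -mulr_suml rpdg_p_sum// mul1r !big_split /= sumrN.
rewrite -!mulr_suml -!mulr_sumr -!edot_suml rpdg_p_sum// mul1r.
have -> : \sum_i e i = dual_gap s by apply: eq_bigr => i _; rewrite sP.
have h1 : (1 + tau) * W - \sum_i bregman (f i) (und s i) xs <= alpha * ((1 + tau) * W).
  rewrite lerBlDl -lerBlDr -{1}[(1 + tau) * W]mul1r -mulrBl mulrA mulr_sumr.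
  apply: ler_sum => i _.
  apply: le_trans (ler_wpM2r (breg0 i _ _) (rpdg_alpha_tau delta m0 Li0 L0 i)) _.
  by rewrite mulVKf// gt_eqF.
have h2 := ler_wpM2r (edot_ge0 a) (rpdg_eta_contract Li m0 d0).
rewrite /lyapunov -/W -/a -/b; move: h1 h2; lra.
Qed.
End Step.
End Lyapunov.

(** * Independent draws *)

Section IndependentDraws.
Context (R : realType) (m : nat) (p : 'I_m -> R).
Implicit Types (F G : seq 'I_m -> R).

(* Conditioning on the first draw, so that one-step bounds iterate by induction on k. *)
Fixpoint iid_mean (k : nat) F : R :=
  if k is k'.+1 then \sum_i p i * iid_mean k' (fun s => F (i :: s)) else F [::].

Lemma iid_meanD k F G :
  iid_mean k (fun s => F s + G s) = iid_mean k F + iid_mean k G.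
Proof.
elim: k F G => [//|k IH] F G /=; rewrite -big_split /=.
by apply: eq_bigr => i _; rewrite IH mulrDr.
Qed.

Lemma iid_meanZ k c F : iid_mean k (fun s => c * F s) = c * iid_mean k F.
Proof.
elim: k F => [//|k IH] F /=; rewrite mulr_sumr.
by apply: eq_bigr => i _; rewrite IH mulrCA.
Qed.

Hypotheses (p0 : forall i, 0 <= p i) (p1 : \sum_i p i = 1).

Lemma iid_mean_cst k c : iid_mean k (fun=> c) = c.
Proof.
elim: k => [//|k IH] /=; under eq_bigr do rewrite IH.
by rewrite -mulr_suml p1 mul1r.
Qed.

Lemma iid_mean_sum k (I : Type) (r : seq I) (F : I -> seq 'I_m -> R) :
  iid_mean k (fun s => \sum_(t <- r) F t s) = \sum_(t <- r) iid_mean k (F t).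
Proof.
elim: r => [|t r IH].
  by under eq_fun do rewrite big_nil; rewrite iid_mean_cst big_nil.
by under eq_fun do rewrite big_cons; rewrite iid_meanD IH big_cons.
Qed.

Lemma le_iid_mean k F G : (forall s, F s <= G s) -> iid_mean k F <= iid_mean k G.
Proof.
elim: k F G => [|k IH] F G FG /=; first exact: FG.
by apply: ler_sum => i _; rewrite ler_wpM2l// IH.
Qed.

Lemma iid_mean_contraction (T : Type) (step : T -> 'I_m -> T) (V : T -> R)
    (inv : T -> Prop) (a : R) : 0 <= a ->
  (forall s i, inv s -> inv (step s i)) ->
  (forall s, inv s -> \sum_i p i * V (step s i) <= a * V s) ->
  forall k t s, (t <= k)%N -> inv s ->
  iid_mean k (fun l => V (foldl step s (take t l))) <= a ^+ t * V s.
Proof.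
move=> a0 invS VS; elim=> [|k IH] [|t] s // tk invs.
- by rewrite expr0 mul1r.
- by under eq_fun do rewrite take0; rewrite iid_mean_cst expr0 mul1r.
apply: (@le_trans _ _ (\sum_i p i * (a ^+ t * V (step s i)))).
  by apply: ler_sum => i _; rewrite ler_wpM2l// IH//; exact: invS.
rewrite exprSr -mulrA; under eq_bigr do rewrite mulrCA.
by rewrite -mulr_sumr ler_wpM2l ?exprn_ge0// VS.
Qed.

Lemma iid_mean_tuple k F :
  iid_mean k F = \sum_(s : k.-tuple 'I_m) (\prod_(i <- s) p i) * F s.
Proof.
elim: k F => [|k IH] F.
  rewrite (big_pred1 [tuple]) /=; first by rewrite big_nil mul1r.
  by move=> s /=; apply/esym/eqP; exact: tuple0.
transitivity (\sum_(q : 'I_m * k.-tuple 'I_m)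
    p q.1 * ((\prod_(i <- q.2) p i) * F (q.1 :: q.2))).
  rewrite /=; under eq_bigr do rewrite IH mulr_sumr.
  by rewrite pair_bigA.
rewrite [RHS](reindex (fun q : 'I_m * k.-tuple 'I_m => [tuple of q.1 :: q.2])) /=.
  by apply: eq_bigr => -[i s] _ /=; rewrite big_cons mulrA.
exists (fun s => (thead s, behead_tuple s)) => [[i s] _|s _] /=.
  by rewrite theadE; congr (_, _); apply: val_inj.
by rewrite [RHS]tuple_eta; apply: val_inj.
Qed.

Context (d : measure_display) (Omega : measurableType d) (P : probability Omega R).
Variables (k : nat) (draw : nat -> Omega -> 'I_m).
Hypotheses (m0 : (0 < m)%N) (ind : independent_draws P p k draw).

Definition draws (w : Omega) : seq 'I_m := [seq draw t w | t <- iota 1 k].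

Let cyl (s : k.-tuple 'I_m) : set Omega := [set w | draws w = s].

Let cylE (s : k.-tuple 'I_m) : cyl s =
  [set w | {in iota 1 k, forall t, draw t w = nth (Ordinal m0) s t.-1}].
Proof.
apply/seteqP; split => w /= h.
  move=> t; rewrite mem_iota => /andP[t1 tk].
  rewrite -h (nth_map 0%N) ?size_iota ?nth_iota; [|lia..].
  by rewrite add1n prednK.
apply: (@eq_from_nth _ (Ordinal m0)); first by rewrite size_map size_iota size_tuple.
move=> i; rewrite size_map size_iota => ik.
rewrite (nth_map 0%N) ?size_iota// nth_iota// h ?add1n//.
by rewrite mem_iota; lia.
Qed.

Let mcyl s : measurable (cyl s).
Proof.
rewrite cylE (_ : [set w | _] = \big[setI/setT]_(t <- iota 1 k)
   [set w | draw t w = nth (Ordinal m0) s t.-1]).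
  rewrite big_seq; apply: bigsetI_measurable => t.
  rewrite mem_iota => tk; apply: (ind.1 t _ _).1; lia.
rewrite -bigcap_seq; apply/seteqP; split => w /= h t tk; exact: h.
Qed.

Let Pcyl s : P (cyl s) = (\prod_(i <- s) p i)%:E.
Proof.
rewrite cylE ind.2 ?iota_uniq//; last by move=> t; rewrite mem_iota; lia.
have sE : tval s = [seq nth (Ordinal m0) s i | i <- iota 0 k].
  by rewrite map_nth_iota0 ?size_tuple// take_oversize// size_tuple.
rewrite [in RHS]sE big_map (iotaDl 1 0) big_map.
rewrite (big_morph EFin (@EFinM R) erefl) big_seq [RHS]big_seq.
apply: eq_bigr => t; rewrite mem_iota => tk.
by rewrite (ind.1 t.+1 _ _).2//; lia.
Qed.

Lemma expectation_draws F : (forall s, 0 <= F s) ->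
  ('E_P[fun w => F (draws w)] = (iid_mean k F)%:E)%E.
Proof.
move=> F0; rewrite unlock.
transitivity (\int[P]_w (\sum_(s : k.-tuple 'I_m) (F s * \1_(cyl s) w)%:E))%E.
  apply: eq_integral => w _ /=.
  have sz : size (draws w) == k by rewrite size_map size_iota.
  rewrite (bigD1 (Tuple sz))//= big1 => [|s sw].
    by rewrite indicE mem_set// mulr1 adde0.
  by rewrite indicE memNset ?mulr0//= => h; case/eqP: sw; apply: val_inj.
rewrite ge0_integral_sum//.
- rewrite iid_mean_tuple -sumEFin; apply: eq_bigr => s _.
  rewrite (integralZl_indic _ (fun=> cyl s))//; last by rewrite ltNge F0.
  rewrite integral_indic// setIT [X in (_ * X)%E](Pcyl s).
  by rewrite -EFinM mulrC.
- move=> s; apply/measurable_EFinP; apply: measurable_funM => //.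
- by move=> s w _; rewrite lee_fin mulr_ge0.
Qed.

Lemma probability_draws (Q : pred (seq 'I_m)) :
  P [set w | Q (draws w)] = (iid_mean k (fun s => (Q s)%:R))%:E.
Proof.
rewrite -expectation_draws; last by move=> s; rewrite ler0n.
have mQ : measurable [set w | Q (draws w)].
  rewrite (_ : [set w | _] = \big[setU/set0]_(s : k.-tuple 'I_m | Q s) cyl s).
    exact: bigsetU_measurable.
  rewrite -bigcup_pred; apply/seteqP; split => w /=.
    move=> Qw; have sz : size (draws w) == k by rewrite size_map size_iota.
    by exists (Tuple sz).
  by move=> [s Qs ->].
rewrite -[in LHS](setIT [set w | _]) -integral_indic// unlock.
apply: eq_integral => w _; rewrite indicE; congr ((nat_of_bool _)%:R%:E).
by apply/idP/idP; rewrite inE.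
Qed.
End IndependentDraws.

(** * Iteration count and relative accuracy *)

Section IterationCount.
Context (R : realType).

(* rpdg_N at delta = L eps / 2, where rpdg_C = 8 + 16 / eps does not depend on L. *)
Definition perturbed_N (m : nat) (eps : R) : R :=
  m%:R + 1 + Num.sqrt ((m%:R - 1) ^+ 2 + 4 * m%:R * (8 + 16 / eps)).

Lemma natr_geometric_le (N : R) (k : nat) : 1 < N ->
  k%:R * (1 - N^-1) ^+ k <= 2 * N * expR (- (k%:R / (2 * N))).
Proof.
move=> N1; have N0 : 0 < N by apply: lt_trans N1.
set y := k%:R / (2 * N).
have y0 : 0 <= y by rewrite divr_ge0// mulr_ge0// ltW.
have kE : k%:R = 2 * N * y by rewrite /y; field; rewrite gt_eqF.
have h1 : (1 - N^-1) ^+ k <= expR (- (2 * y)).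
  have -> : - (2 * y) = k%:R * (- N^-1) by rewrite kE; field; rewrite gt_eqF.
  rewrite expRM_natl lerXn2r ?nnegrE ?expR_ge0 ?expR_ge1Dx//.
  by rewrite subr_ge0 invf_le1// ltW.
rewrite {1}kE -[leLHS]mulrA ler_pM2l ?mulr_gt0//.
apply: (le_trans (ler_wpM2l y0 h1)).
have -> : - (2 * y) = - y - y by ring.
rewrite expRD mulrA ler_piMl ?expR_ge0// expRN ler_pdivrMr ?expR_gt0// mul1r.
by apply: le_trans (expR_ge1Dx y); rewrite lerDr.
Qed.

Lemma perturbed_N_le (c : R) (m : nat) (eps : R) : (0 < m)%N -> 0 < eps ->
  m%:R * eps <= c ->
  perturbed_N m eps <= (2 * Num.sqrt c + 2 * Num.sqrt (8 * c + 16)) * Num.sqrt (m%:R / eps).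
Proof.
move=> m0 e0 mc; have m1 : (1 : R) <= m%:R by rewrite ler1n.
have mR0 : (0 : R) < m%:R by rewrite ltr0n.
have c0 : 0 < c by apply: lt_le_trans mc; rewrite mulr_gt0.
have ec : eps <= c by apply: le_trans mc; rewrite ler_peMl// ltW.
have q0 : 0 < m%:R / eps by rewrite divr_gt0.
have h1 : m%:R <= Num.sqrt c * Num.sqrt (m%:R / eps).
  rewrite -sqrtrM ?(ltW c0)// -[leLHS]ger0_norm ?(ltW mR0)// -sqrtr_sqr.
  rewrite ler_sqrt ?(mulr_ge0 (ltW c0) (ltW q0))//.
  by rewrite mulrA ler_pdivlMr// mulrC expr2 mulrA ler_pM2r// mulrC.
set T := Num.sqrt (8 * c + 16).
have T0 : 0 <= T by apply: sqrtr_ge0.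
set q := Num.sqrt (m%:R / eps) in h1 *.
have q0' : 0 < q by rewrite sqrtr_gt0.
have qq : q ^+ 2 = m%:R / eps by rewrite sqr_sqrtr// ltW.
have TT : T ^+ 2 = 8 * c + 16 by rewrite sqr_sqrtr//; lra.
have h2 : Num.sqrt ((m%:R - 1) ^+ 2 + 4 * m%:R * (8 + 16 / eps)) <= (m%:R - 1) + 2 * (T * q).
  have nn : 0 <= m%:R - 1 + 2 * (T * q) by rewrite addr_ge0 ?subr_ge0// !mulr_ge0// ltW.
  rewrite -[leRHS]ger0_norm// -sqrtr_sqr ler_sqrt ?sqr_ge0//.
  rewrite [leRHS]sqrrD -[leRHS]addrA lerD2l -[leLHS]add0r lerD//.
    by rewrite mulrn_wge0// mulr_ge0 ?subr_ge0// !mulr_ge0// ltW.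
  rewrite !exprMn TT qq.
  have -> : 4 * m%:R * (8 + 16 / eps) = 2 ^+ 2 * ((8 * eps + 16) * (m%:R / eps)).
    by field; rewrite gt_eqF.
  by rewrite ler_pM2l// ler_pM2r// lerD2r ler_pM2l.
rewrite /perturbed_N; move: (Num.sqrt ((m%:R - 1) ^+ 2 + _)) h2 => S' h2.
by move: (Num.sqrt c) (T) (q) h1 h2 => Q' T' q'; lra.
Qed.

Lemma iteration_count (c : R) : 0 < c -> exists2 K : R, 0 < K &
  forall (m : nat) (eps lam : R), (0 < m)%N -> 0 < eps -> m%:R * eps <= c ->
    0 < lam -> lam <= 1 -> 2 * (lam * eps) <= m%:R ->
  exists k : nat, [/\ (0 < k)%N,
    k%:R <= K * (Num.sqrt (m%:R / eps) * ln (m%:R / (lam * eps))) &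
    (1 + eps / 2) * (1 + 4 / eps) * (k%:R * (1 - (perturbed_N m eps)^-1) ^+ k)
      <= lam * (eps / 2)].
Proof.
move=> c0; set Q := Num.sqrt c.
have Q0 : 0 < Q by rewrite sqrtr_gt0.
pose N0 := 2 * Q + 2 * Num.sqrt (8 * c + 16).
have N00 : 0 < N0 by rewrite ltr_pwDl ?mulr_gt0// mulr_ge0// sqrtr_ge0.
pose B := 3 * c + c ^+ 2 / 2 + 4.
have B0 : 0 < B by rewrite /B; have := sqr_ge0 c; lra.
pose A := 1 + 4 * N0 * Q * B.
have A1 : 1 <= A by rewrite lerDl !mulr_ge0// ltW.
have A0 : 0 < A by apply: lt_le_trans A1.
have l2 : 0 < ln (2 : R) by rewrite ln_gt0// ltr1n.
have lA : 0 <= ln A by rewrite ln_ge0.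
exists (2 * N0 * (ln A / ln 2 + 3) + Q / ln 2).
  apply: ltr_wpDl (divr_gt0 Q0 l2); apply: mulr_ge0; first by rewrite mulr_ge0// ltW.
  by rewrite addr_ge0// divr_ge0// ltW.
move=> m eps lam m0 e0 mc lam0 lam1 h2.
set N := perturbed_N m eps; set q := Num.sqrt _; set z := m%:R / (lam * eps).
have m1 : (1 : R) <= m%:R by rewrite ler1n.
have mR0 : (0 : R) < m%:R by rewrite ltr0n.
have ec : eps <= c by apply: le_trans mc; rewrite ler_peMl// ltW.
have le0 : 0 < lam * eps by rewrite mulr_gt0.
have qq : q ^+ 2 = m%:R / eps by rewrite sqr_sqrtr// divr_ge0// ltW.
have q0 : 0 < q by rewrite sqrtr_gt0 divr_gt0.
have N1 : 1 < N.
  rewrite /N/perturbed_N.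
  have := sqrtr_ge0 ((m%:R - 1) ^+ 2 + 4 * m%:R * (8 + 16 / eps)); move: m1; lra.
have NN0 : N <= N0 * q by apply: perturbed_N_le.
have z2 : 2 <= z by rewrite ler_pdivlMr.
have z0 : 0 < z by apply: lt_le_trans z2.
have Qq : 1 <= Q * q.
  rewrite -sqrtrM ?(ltW c0)// -[leLHS]sqrtr1 ler_sqrt; last first.
    by rewrite mulr_ge0 ?(ltW c0)// divr_ge0// ltW.
  rewrite mulrA ler_pdivlMr// mul1r; apply: (le_trans ec); rewrite ler_peMr// ltW//.
have qz : q ^+ 2 <= z.
  by rewrite qq /z ler_pM2l// lef_pV2 ?posrE// ler_piMl// ltW.
have qQz : q <= Q * z.
  apply: le_trans (_ : Q * q ^+ 2 <= _); last by rewrite ler_pM2l.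
  by rewrite expr2 mulrA ler_peMl// ltW.
have lz : ln 2 <= ln z by rewrite ler_ln ?posrE.
have lz0 : 0 <= ln z by apply: le_trans lz; exact: ltW.
pose X := 2 * N * ln (A * z ^+ 3).
have Az0 : 0 < A * z ^+ 3 by rewrite mulr_gt0// exprn_gt0.
have lAz : ln (A * z ^+ 3) = ln A + 3 * ln z.
  by rewrite lnM ?posrE ?exprn_gt0// lnXn// mulr_natl.
have X0 : 0 <= X.
  rewrite /X lAz; apply: mulr_ge0; first by rewrite mulr_ge0// ltW// (lt_trans _ N1).
  by rewrite addr_ge0// mulr_ge0.
exists (Num.truncn X).+1; split=> //.
  have -> : (Num.truncn X).+1%:R = (Num.truncn X)%:R + 1 :> R by rewrite -natr1.
  apply: (@le_trans _ _ (X + 1)); first by rewrite lerD2r truncn_le.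
  rewrite mulrDl; apply: lerD.
    have -> : 2 * N0 * (ln A / ln 2 + 3) * (q * ln z) =
        (2 * (N0 * q)) * ((ln A / ln 2 + 3) * ln z) by ring.
    rewrite /X lAz; apply: ler_pM.
    - by rewrite mulr_ge0// ltW// (lt_trans _ N1).
    - by rewrite addr_ge0// mulr_ge0.
    - by rewrite ler_pM2l.
    - rewrite [leRHS]mulrDl lerD2r -mulrA ler_peMr// mulrC ler_pdivlMr// mul1r//.
  have -> : Q / ln 2 * (q * ln z) = (Q * q) * (ln z / ln 2) by ring.
  by rewrite mulr_ege1// ler_pdivlMr// mul1r.
set k := (Num.truncn X).+1.
have kX : X <= k%:R by apply/ltW/truncnS_gt.
have E : (1 + eps / 2) * (1 + 4 / eps) = (3 * eps + eps ^+ 2 / 2 + 4) / eps.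
  by field; rewrite gt_eqF.
have EB : (1 + eps / 2) * (1 + 4 / eps) <= B / eps.
  rewrite E ler_pM2r ?invr_gt0//; rewrite /B.
  have : eps ^+ 2 <= c ^+ 2 by rewrite ler_sqr ?nnegrE ?(ltW e0) ?(ltW c0).
  by move: ec; lra.
have ek : expR (- (k%:R / (2 * N))) <= (A * z ^+ 3)^-1.
  rewrite -(lnK Az0) -expRN ler_expR lerN2.
  rewrite ler_pdivlMr; last by move: N1; lra.
  by apply: le_trans kX; rewrite mulrC.
have N_ge0 : 0 <= 2 * N by rewrite mulr_ge0// ltW// (lt_trans _ N1).
have alpha_ge0 : 0 <= 1 - N^-1 by rewrite subr_ge0 invf_le1 ?(ltW N1)// (lt_trans _ N1).
have step1 : k%:R * (1 - N^-1) ^+ k <= 2 * N * (A * z ^+ 3)^-1.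
  exact: le_trans (natr_geometric_le k N1) (ler_wpM2l N_ge0 ek).
apply: (le_trans (ler_pM _ _ EB step1)).
- by rewrite mulr_ge0// addr_ge0// divr_ge0// ltW.
- by rewrite mulr_ge0// exprn_ge0.
have -> : B / eps * (2 * N * (A * z ^+ 3)^-1) = (2 * B * N) / (eps * (A * z ^+ 3)).
  by field; rewrite !gt_eqF.
rewrite ler_pdivrMr ?(mulr_gt0 e0 Az0)//.
have -> : lam * (eps / 2) * (eps * (A * z ^+ 3)) = A * z / 2 * (lam * (eps * z) ^+ 2) by field.
have h3 : 1 <= lam * (eps * z) ^+ 2.
  have -> : lam * (eps * z) ^+ 2 = m%:R ^+ 2 / lam by rewrite /z; field; rewrite !gt_eqF.
  by rewrite ler_pdivlMr// mul1r (le_trans lam1)// exprn_ege1.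
apply: (@le_trans _ _ (A * z / 2)); last by rewrite ler_peMr// divr_ge0// mulr_ge0// ltW.
apply: (@le_trans _ _ (2 * B * (N0 * (Q * z)))).
  by rewrite ler_pM2l ?mulr_gt0// (le_trans NN0)// ler_pM2l.
have -> : 2 * B * (N0 * (Q * z)) = (4 * N0 * Q * B) * z / 2 by field.
by rewrite ler_pM2r// ler_pM2r// /A lerDr.
Qed.
End IterationCount.

Section Perturbation.
Context (R : realType) (m n : nat) (f : 'I_m -> 'rV[R]_n -> R^o) (Li : 'I_m -> R).
Variable (x0 : 'rV[R]_n).
Local Notation L := (\sum_(i < m) Li i).
Hypothesis H : smooth_convex_sum f Li.

Lemma min_valueE u : minimizers (fsum f) u -> min_value (fsum f) = fsum f u.
Proof.
move=> mu; apply/eqP; rewrite eq_le; apply/andP; split.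
  by apply: ge_inf; [exists (fsum f u) => _ [x _ <-]|exists u].
by apply: lb_le_inf; [exists (fsum f u), u|move=> _ [x _ <-]].
Qed.

Lemma fsum_quadratic_le x y :
  fsum f y <= fsum f x + edot (\sum_i gradient (f i) x) (y - x)
    + L / 2 * edot (y - x) (y - x).
Proof.
have [_ df lf _ _] := H.
rewrite edot_suml -big_split /= -mulrA mulr_suml -big_split /=.
apply: ler_sum => i _.
by have := bregman_le (df i) (lf i).2 x y; rewrite /bregman; lra.
Qed.

Lemma continuous_fsum : continuous (fsum f).
Proof.
have [_ df _ _ _] := H.
apply: (@continuous_big R^o) => [|j _ x]; first exact: add_continuous.
exact: differentiable_continuous.
Qed.

Variable (d : R).
Hypothesis d0 : 0 < d.

Lemma perturbed_solution : exists xs : 'rV[R]_n,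
  \sum_i gradient (f i) xs + d *: (xs - x0) = 0 /\
  forall u, minimizers (fsum f) u ->
    fsum f xs + d / 2 * edot (xs - x0) (xs - x0) <= fsum f u + d / 2 * edot (x0 - u) (x0 - u).
Proof.
have [_ df lf L0 [u mu]] := H.
have [xs xsP] := perturbation_minimizer x0 d0 continuous_fsum mu.
exists xs; split; last first.
  by move=> v _; rewrite -[x0 - v]opprB edotNl edotNr opprK.
set g := \sum_i _; set G := g + _.
(* A gradient step of length 1 / (L + d) would decrease the objective unless G = 0. *)
have Ld : 0 < L + d by rewrite addr_gt0.
have h1 := xsP (xs - (L + d)^-1 *: G).
have h2 := fsum_quadratic_le xs (xs - (L + d)^-1 *: G).
have E1 : xs - (L + d)^-1 *: G - xs = - ((L + d)^-1 *: G) by rewrite addrAC subrr add0r.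
have E2 : xs - (L + d)^-1 *: G - x0 = xs - x0 - (L + d)^-1 *: G by rewrite addrAC.
rewrite E1 -/g in h2; rewrite E2 in h1.
have gE : g = G - d *: (xs - x0) by rewrite /G addrK.
move: h1 h2; rewrite gE; move: (xs - x0) (G) => a G'.
rewrite !edotE (edotC a G') => h1 h2.
have h3 : edot G' G' / (2 * (L + d)) <= 0.
  have -> : edot G' G' / (2 * (L + d)) = (L + d)^-1 * edot G' G'
      - (L + d) / 2 * ((L + d)^-1 * ((L + d)^-1 * edot G' G')) by field; rewrite gt_eqF.
  lra.
apply/eqP; rewrite -edot_eq0 eq_le edot_ge0 andbT.
by move: h3; rewrite ler_pdivrMr ?mul0r// mulr_gt0.
Qed.

Variable xs : 'rV[R]_n.
Hypothesis xsP : \sum_i gradient (f i) xs + d *: (xs - x0) = 0.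
Hypothesis xsmin : forall u, minimizers (fsum f) u ->
    fsum f xs + d / 2 * edot (xs - x0) (xs - x0) <= fsum f u + d / 2 * edot (x0 - u) (x0 - u).
Local Notation D := (min_sqdist x0 (minimizers (fsum f))).

Lemma min_sqdist_ge a : (forall u, minimizers (fsum f) u -> a <= edot (x0 - u) (x0 - u)) -> a <= D.
Proof.
have [_ _ _ _ [u mu]] := H; move=> h; apply: lb_le_inf; first by exists (enorm (x0 - u) ^+ 2), u.
by move=> _ [v mv <-]; rewrite enorm_sq; exact: h.
Qed.

Lemma min_sqdist_ge0 : 0 <= D.
Proof. by apply: min_sqdist_ge => u _; exact: edot_ge0. Qed.

Lemma perturbed_dist_le : edot (x0 - xs) (x0 - xs) <= D.
Proof.
apply: min_sqdist_ge => u mu; have := xsmin mu.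
rewrite -[x0 - xs]opprB edotNl edotNr opprK.
have := mu xs => h1 h2; rewrite -(ler_pM2l (_ : 0 < d / 2)) ?divr_gt0//; lra.
Qed.

Lemma fsum_gap_le x : fsum f x - min_value (fsum f) <=
  (L + d) / 2 * edot (x - xs) (x - xs) + d / 2 * D.
Proof.
suff h u : minimizers (fsum f) u ->
    fsum f x - fsum f u <= (L + d) / 2 * edot (x - xs) (x - xs) + d / 2 * edot (x0 - u) (x0 - u).
  have [_ _ _ _ [v mv]] := H; rewrite (min_valueE mv).
  have : (fsum f x - fsum f v - (L + d) / 2 * edot (x - xs) (x - xs)) / (d / 2) <= D.
    apply: min_sqdist_ge => u mu; rewrite ler_pdivrMr ?divr_gt0//.
    by have := h u mu; rewrite -!(min_valueE mu) -(min_valueE mv); lra.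
  by rewrite ler_pdivrMr ?divr_gt0//; lra.
move=> mu; have h1 := xsmin mu; have h2 := fsum_quadratic_le xs x.
have gE : \sum_i gradient (f i) xs = - (d *: (xs - x0)) by apply/eqP; rewrite -addr_eq0 xsP.
move: h1 h2; rewrite gE; have := edot_ge0 (x - x0).
have -> : x - x0 = (x - xs) + (xs - x0) by rewrite addrA subrK.
move: (x - xs) (xs - x0) => a b; rewrite !edotE (edotC b a) => h0 h1 h2.
have := mulr_ge0 (ltW d0) h0; lra.
Qed.

End Perturbation.

Section RelativeAccuracy.
Context (R : realType) (m n : nat) (f : 'I_m -> 'rV[R]_n -> R^o) (Li : 'I_m -> R).
Variables (x0 : 'rV[R]_n) (eps : R) (k : nat).
Local Notation L := (\sum_(i < m) Li i).
Local Notation delta := (L * eps / 2).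
Local Notation alpha := (rpdg_alpha Li delta).
Hypotheses (H : smooth_convex_sum f Li) (m0 : (0 < m)%N) (e0 : 0 < eps) (k0 : (0 < k)%N).
Local Notation D := (min_sqdist x0 (minimizers (fsum f))).

Let L0 : 0 < L. Proof. by have [] := H. Qed.
Let d0 : 0 < delta. Proof. by rewrite divr_gt0// mulr_gt0. Qed.

Lemma rpdg_alpha_perturbed : alpha = 1 - (perturbed_N m eps)^-1.
Proof.
rewrite rpdg_alphaE /rpdg_N /perturbed_N.
have -> // : rpdg_C Li delta = 8 + 16 / eps.
by rewrite /rpdg_C; field; rewrite !gt_eqF.
Qed.

Definition rpdg_run (l : seq 'I_m) : rpdg_state R m n :=
  foldl (fun s i => rpdg_step f Li x0 delta i s) (rpdg_init f x0) l.

Lemma rpdg_runE draw t : rpdg f Li x0 delta draw t = rpdg_run [seq draw i | i <- iota 1 t].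
Proof.
elim: t => [//|t IH].
have -> : iota 1 t.+1 = iota 1 t ++ [:: t.+1] by rewrite -{1}(addn1 t) iotaD add1n.
by rewrite map_cat /rpdg_run foldl_cat -/(rpdg_run _) -IH.
Qed.

Definition rpdg_average (l : seq 'I_m) : 'rV[R]_n :=
  (\sum_(1 <= t < k.+1) alpha ^- t)^-1 *:
  \sum_(1 <= t < k.+1) alpha ^- t *: cur (rpdg_run (take t l)).

Lemma rpdg_outputE draw :
  rpdg_output f Li x0 delta draw k = rpdg_average [seq draw i | i <- iota 1 k].
Proof.
congr (_ *: _); apply: eq_big_nat => t /andP[t1 tk].
by rewrite rpdg_runE -map_take take_iota (minn_idPl _).
Qed.

Lemma rpdg_mean_dist xs :
  \sum_i gradient (f i) xs + delta *: (xs - x0) = 0 ->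
  iid_mean (rpdg_p Li) k (fun l => edot (rpdg_average l - xs) (rpdg_average l - xs)) <=
  k%:R * alpha ^+ k * ((1 + 4 / eps) * edot (x0 - xs) (x0 - xs)).
Proof.
move=> xsP; have [cf df lf _ _] := H.
have Li0 i : 0 <= Li i by exact: (lf i).1.
have p0 i : 0 <= rpdg_p Li i by rewrite ltW// rpdg_p_gt0.
have a0 : 0 < alpha by exact: rpdg_alpha_gt0.
set S := \sum_(1 <= t < k.+1) alpha ^- t.
have S0 : alpha ^- k <= S.
  by rewrite /S big_nat_recr//= lerDr; apply: sumr_ge0 => t _; rewrite invr_ge0 exprn_ge0// ltW.
have S00 : 0 < S by apply: lt_le_trans S0; rewrite invr_gt0 exprn_gt0.
set B := (1 + 4 / eps) * _.
have B0 : 0 <= B by rewrite mulr_ge0 ?edot_ge0// addr_ge0// divr_ge0// ltW.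
have mean_t t : (t <= k)%N -> iid_mean (rpdg_p Li) k (fun l =>
    edot (cur (rpdg_run (take t l)) - xs) (cur (rpdg_run (take t l)) - xs)) <= alpha ^+ t * B.
  move=> tk.
  have c0 : 0 < rpdg_eta Li delta / 2 + delta.
    by rewrite addr_gt0// divr_gt0// rpdg_eta_gt0.
  rewrite -(ler_pM2l c0) -iid_meanZ.
  have inv l : dual_is_gradient f (rpdg_run l).
    rewrite /rpdg_run; have : dual_is_gradient f (rpdg_init f x0) by [].
    elim: l (rpdg_init f x0) => [//|i l IH] s sP /=.
    exact/IH/dual_is_gradient_step.
  apply: (@le_trans _ _ (iid_mean (rpdg_p Li) k (fun l =>
      lyapunov f Li xs delta (rpdg_run (take t l))))).
    apply: le_iid_mean => // l.
    exact: (lyapunov_ge xs m0 L0 d0 Li0 df cf (fun i => (lf i).2) (inv (take t l))).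
  apply: le_trans (iid_mean_contraction p0 (rpdg_p_sum m0 L0)
    (step := fun s i => rpdg_step f Li x0 delta i s) (V := lyapunov f Li xs delta)
    (inv := dual_is_gradient f) (ltW a0) _ _ tk (inv [::])) _.
  - by move=> s i sP; exact: dual_is_gradient_step.
  - by move=> s sP; apply: (lyapunov_step m0 L0 d0 Li0 df cf (fun i => (lf i).2) xsP).
  rewrite mulrCA ler_wpM2l ?exprn_ge0 ?(ltW a0)//.
  apply: le_trans (lyapunov_init x0 xs m0 L0 d0 Li0 df (fun i => (lf i).2)) _.
  rewrite /B; have -> // : 2 * L / delta = 4 / eps by field; rewrite !gt_eqF.
apply: (@le_trans _ _ (S^-1 * (k%:R * B))); last first.
  rewrite mulrC [leRHS]mulrAC ler_wpM2l ?(mulr_ge0 _ B0)//.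
  by rewrite invf_ple ?posrE ?exprn_gt0.
apply: (@le_trans _ _ (iid_mean (rpdg_p Li) k (fun l => S^-1 * \sum_(1 <= t < k.+1)
   alpha ^- t * edot (cur (rpdg_run (take t l)) - xs) (cur (rpdg_run (take t l)) - xs)))).
  apply: le_iid_mean => // l.
  by apply: edot_convex_sum => // t; rewrite invr_ge0 exprn_ge0// ltW.
rewrite iid_meanZ iid_mean_sum ?rpdg_p_sum// ler_pM2l ?invr_gt0//.
have -> : k%:R * B = \sum_(1 <= t < k.+1) B by rewrite sumr_const_nat subn1 mulr_natl.
rewrite !big_nat; apply: ler_sum => t /andP[t1 tk].
rewrite iid_meanZ mulrC ler_pdivrMr ?exprn_gt0// mulrC; exact: mean_t.
Qed.

Definition accuracy_excess xs l : R :=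
  (1 + eps / 2) / (1 + D) * edot (rpdg_average l - xs) (rpdg_average l - xs).

Lemma Rac_ge0 x : 0 <= Rac f Li x0 x.
Proof.
have [_ _ _ _ [u mu]] := H.
apply: divr_ge0.
  by apply: mulr_ge0 => //; rewrite (min_valueE mu) subr_ge0; exact: mu.
by rewrite mulr_ge0 ?(ltW L0)// addr_ge0// (min_sqdist_ge0 x0 H).
Qed.

Lemma Rac_mean : exists2 G : seq 'I_m -> R,
  (forall l, 0 <= G l) /\ (forall l, Rac f Li x0 (rpdg_average l) <= G l + eps / 2) &
  iid_mean (rpdg_p Li) k G <= (1 + eps / 2) * (1 + 4 / eps) * (k%:R * alpha ^+ k).
Proof.
have [xs [xsP xsmin]] := perturbed_solution x0 H d0.
have D0 : 0 <= D by exact: min_sqdist_ge0 H.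
have D1 : 0 < 1 + D by rewrite ltr_pwDl.
exists (accuracy_excess xs); first split.
- move=> l; apply: mulr_ge0 (edot_ge0 _).
  by rewrite divr_ge0 ?(ltW D1)// addr_ge0// divr_ge0// ltW.
- move=> l; rewrite /Rac /accuracy_excess; set A := edot _ _.
  have := fsum_gap_le H d0 xsP xsmin (rpdg_average l); rewrite -/A => h.
  rewrite ler_pdivrMr ?mulr_gt0//.
  have -> : ((1 + eps / 2) / (1 + D) * A + eps / 2) * (L * (1 + D)) =
      2 * ((L + delta) / 2 * A + delta / 2 * D) + L * eps / 2.
    by field; rewrite gt_eqF.
  by move: h (ltW d0); lra.
rewrite iid_meanZ.
apply: (@le_trans _ _ ((1 + eps / 2) / (1 + D) * (k%:R * alpha ^+ k * ((1 + 4 / eps) * D)))).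
  have h : 0 <= (1 + eps / 2) / (1 + D).
    by rewrite divr_ge0 ?(ltW D1)// addr_ge0// divr_ge0// ltW.
  rewrite ler_wpM2l//; apply: le_trans (rpdg_mean_dist xsP) _.
  rewrite ler_wpM2l ?mulr_ge0 ?exprn_ge0 ?(ltW (rpdg_alpha_gt0 _ _ m0))//.
  rewrite ler_wpM2l ?(perturbed_dist_le H d0 xsmin)//.
  by rewrite addr_ge0// divr_ge0// ltW.
set X := k%:R * alpha ^+ k.
have X0 : 0 <= X by rewrite mulr_ge0// exprn_ge0// ltW// rpdg_alpha_gt0.
have -> : (1 + eps / 2) / (1 + D) * (X * ((1 + 4 / eps) * D)) =
    (1 + eps / 2) * (1 + 4 / eps) * X * (D / (1 + D)).
  by field; rewrite !gt_eqF.
rewrite ler_piMr//; last by rewrite ler_pdivrMr// mul1r lerDr.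
apply: mulr_ge0 X0; apply: mulr_ge0; first by rewrite addr_ge0// divr_ge0// ltW.
by rewrite addr_ge0// divr_ge0// ltW.
Qed.
End RelativeAccuracy.

Lemma perturbed_rpdg_accuracy (R : realType) (m n k : nat)
    (f : 'I_m -> 'rV[R]_n -> R^o) (Li : 'I_m -> R) (x0 : 'rV[R]_n) (eps lam : R)
    (d : measure_display) (Omega : measurableType d) (P : probability Omega R)
    (draw : nat -> Omega -> 'I_m) :
  (0 < m)%N -> (0 < k)%N -> 0 < eps -> 0 < lam -> smooth_convex_sum f Li ->
  (1 + eps / 2) * (1 + 4 / eps) * (k%:R * (1 - (perturbed_N m eps)^-1) ^+ k)
    <= lam * (eps / 2) ->
  independent_draws P (rpdg_p Li) k draw ->
  let delta := (\sum_(i < m) Li i) * eps / 2 in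
  let xbar w := rpdg_output f Li x0 delta (fun t => draw t w) k in
  ('E_P[fun w => Rac f Li x0 (xbar w)] <= (lam * (eps / 2) + eps / 2)%:E)%E /\
  (P [set w | (eps < Rac f Li x0 (xbar w))%R] <= lam%:E)%E.
Proof.
move=> m0 k0 e0 lam0 H kP ind delta xbar.
have [_ _ lf L0 _] := H.
have p0 i : 0 <= rpdg_p Li i by rewrite ltW// rpdg_p_gt0// => j; exact: (lf j).1.
have p1 := rpdg_p_sum m0 L0.
have [G [G0 GR] Gmean] := Rac_mean x0 H m0 e0 k0.
have {kP}Gmean : iid_mean (rpdg_p Li) k G <= lam * (eps / 2).
  by apply: le_trans kP; rewrite -(rpdg_alpha_perturbed H e0).
have xbarE w : xbar w = rpdg_average f Li x0 eps k (draws k draw w).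
  exact: rpdg_outputE.
pose r l := Rac f Li x0 (rpdg_average f Li x0 eps k l).
split.
  have -> : (fun w => Rac f Li x0 (xbar w)) = (fun w => r (draws k draw w)).
    by apply/funext => w; rewrite xbarE.
  rewrite (expectation_draws m0 ind) => [|l]; last exact: Rac_ge0.
  rewrite lee_fin; apply: (le_trans (le_iid_mean p0 _ GR)).
  by rewrite iid_meanD iid_mean_cst// lerD2r.
have -> : [set w | eps < Rac f Li x0 (xbar w)] = [set w | eps < r (draws k draw w)].
  by apply/seteqP; split=> w; rewrite /= xbarE.
rewrite (probability_draws m0 ind (fun l => eps < r l)).
rewrite lee_fin -(ler_pM2r (_ : 0 < eps / 2)) ?divr_gt0//.
apply: le_trans Gmean; rewrite mulrC -iid_meanZ; apply: le_iid_mean => // l.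
case: ltP => h; last by rewrite mulr0.
by rewrite mulr1; have := GR l; move: h; rewrite -/(r l); lra.
Qed.

Theorem proposition4 (R : realType) (c : R) (hc : 0 < c) :
  exists K : R, 0 < K /\
  forall (m : nat) (eps : R), (0 < m)%N -> 0 < eps ->
    m%:R * eps <= c ->
    (2 * eps <= m%:R ->
     exists k : nat,
      [/\ (0 < k)%N,
          k%:R <= K * (Num.sqrt (m%:R / eps) * ln (m%:R / eps))
        & forall (n : nat) (f : 'I_m -> 'rV[R]_n -> R^o) (Li : 'I_m -> R)
                 (x0 : 'rV[R]_n),
            smooth_convex_sum f Li ->
            let delta := (\sum_(i < m) Li i) * eps / 2 in
            forall (d : measure_display) (Omega : measurableType d)
                   (P : probability Omega R) (draw : nat -> Omega -> 'I_m),
              independent_draws P (rpdg_p Li) k draw ->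
              let xbar (w : Omega) := rpdg_output f Li x0 delta (fun t => draw t w) k in
              ('E_P[fun w => Rac f Li x0 (xbar w)] <= eps%:E)%E])
    /\
    (forall lam : R, 0 < lam < 1 -> 2 * (lam * eps) <= m%:R ->
     exists k : nat,
      [/\ (0 < k)%N,
          k%:R <= K * (Num.sqrt (m%:R / eps) * ln (m%:R / (lam * eps)))
        & forall (n : nat) (f : 'I_m -> 'rV[R]_n -> R^o) (Li : 'I_m -> R)
                 (x0 : 'rV[R]_n),
            smooth_convex_sum f Li ->
            let delta := (\sum_(i < m) Li i) * eps / 2 in
            forall (d : measure_display) (Omega : measurableType d)
                   (P : probability Omega R) (draw : nat -> Omega -> 'I_m),
              independent_draws P (rpdg_p Li) k draw ->
              let xbar (w : Omega) := rpdg_output f Li x0 delta (fun t => draw t w) k in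
              (P [set w | (eps < Rac f Li x0 (xbar w))%R] <= lam%:E)%E]).
Proof.
have [K K0 KP] := iteration_count hc.
exists K; split=> // m eps m0 e0 mc; split.
  move=> me; have [|k [k0 kK kP]] := KP m eps 1 m0 e0 mc ltr01 (lexx _).
    by rewrite mul1r.
  exists k; split=> //; first by move: kK; rewrite mul1r.
  move=> n f Li x0 H delta d Omega P draw ind.
  have [+ _] := perturbed_rpdg_accuracy x0 m0 k0 e0 ltr01 H kP ind.
  by rewrite mul1r -splitr.
move=> lam /andP[lam0 lam1] lme.
have [k [k0 kK kP]] := KP m eps lam m0 e0 mc lam0 (ltW lam1) lme.
exists k; split=> // n f Li x0 H delta d Omega P draw ind.
by have [] := perturbed_rpdg_accuracy x0 m0 k0 e0 lam0 H kP ind.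
Qed.
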